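(* Let $u\in\mathcal{F}_{\mathrm C}(\mathbb{R})$ and $w\in\mathcal{F}_{\mathrm D}(\mathbb{R})$. Suppose that: (i) $w(w^-(0))=u(u^-(0))$ and $w(w^+(0))=u(u^+(0))$; (ii-1) if $u^-(1)$ is an inner point of $[u]_0$ at which $u$ is not differentiable, then $w'_-(w^-(1))=0$; (ii-2) if $u^+(1)$ is an inner point of $[u]_0$ at which $u$ is not differentiable, then $w'_+(w^+(1))=0$; (iv) for every $x\in(u^-(0),u^+(0))$ at which $u$ is not differentiable: (iv-1) if $u^-(0)<x<u^-(1)$, then $w'_+(w^-(\alpha))=0$, where $\alpha=u(x)$; (iv-2) if $u^+(1)<x<u^+(0)$, then $w'_-(w^+(\beta))=0$, where $\beta=u(x)$. Then $w$ is a smoother of $u$, i.e. $u\nabla w\in\mathcal{F}_{\mathrm D}(\mathbb{R})$.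
   Context: A fuzzy number is a map $u:\mathbb{R}\to[0,1]$ such that, writing $[u]_\alpha=\{x:u(x)\ge\alpha\}$ for $\alpha\in(0,1]$ and $[u]_0=\overline{\{x:u(x)>0\}}$, the set $[u]_1$ is nonempty and each $[u]_\alpha=[u^-(\alpha),u^+(\alpha)]$, $\alpha\in[0,1]$, is a compact interval. $\mathcal{F}(\mathbb{R})$ is the set of all fuzzy numbers. $\mathcal{F}_{\mathrm C}(\mathbb{R})$: fuzzy numbers $u$ continuous on $[u]_0$ (i.e. the restriction to $[u]_0$ is continuous). $\mathcal{F}_{\mathrm D}(\mathbb{R})$: those $u\in\mathcal{F}_{\mathrm C}(\mathbb{R})$ differentiable on $(u^-(0),u^+(0))$. The sup-min convolution is $(u\nabla v)(x)=\sup_{y\in\mathbb{R}}\min\{u(y),v(x-y)\}$; it is a fuzzy number with $[u\nabla v]_\alpha=[u]_\alpha+[v]_\alpha$. For $u\in\mathcal{F}(\mathbb{R})$ and $v\in\mathcal{F}_{\mathrm D}(\mathbb{R})$, $v$ is a smoother of $u$ if $u\nabla v\in\mathcal{F}_{\mathrm D}(\mathbb{R})$. $f'_-,f'_+$ denote left and right derivatives. An inner point of $[u]_0$ is a point of $(u^-(0),u^+(0))$. *)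

(* Defs.v *)
From HB Require Import structures.
From mathcomp Require Import all_boot all_order all_algebra.
From mathcomp Require Import all_classical all_reals all_analysis.

Set Implicit Arguments.
Unset Strict Implicit.
Unset Printing Implicit Defensive.

Import Order.TTheory GRing.Theory Num.Theory.
Import numFieldNormedType.Exports.

Local Open Scope classical_set_scope.
Local Open Scope ring_scope.

Definition level (R : realType) (u : R -> R) (a : R) : set R :=
  if a == 0 then closure [set x | 0 < u x] else [set x | a <= u x].

Definition fuzzy_number (R : realType) (u : R -> R) : Prop :=
  [/\ forall x : R, 0 <= u x <= 1,
      level u 1 !=set0
    & forall a : R, 0 <= a <= 1 ->
        exists l r : R, l <= r /\ level u a = `[l, r]%classic].

(* The endpoints u^-(a) and u^+(a) of the level sets; they are meaningful for
   a fuzzy number u and 0 <= a <= 1 only (see fuzzy_levelE). *)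
Definition lend (R : realType) (u : R -> R) (a : R) : R := inf (level u a).
Definition rend (R : realType) (u : R -> R) (a : R) : R := sup (level u a).

Lemma fuzzy_levelE (R : realType) (u : R -> R) (a : R) :
  fuzzy_number u -> 0 <= a <= 1 -> level u a = `[lend u a, rend u a]%classic.
Proof.
move=> [_ _ +] a01 => /(_ _ a01) [l [r [lr E]]].
by rewrite /lend /rend E inf_itv ?sup_itv // bnd_simp.
Qed.

Definition fuzzyC (R : realType) (u : R -> R) : Prop :=
  fuzzy_number u /\ {within level u 0, continuous u}.

Definition fuzzyD (R : realType) (u : R -> R) : Prop :=
  fuzzyC u /\ forall x : R, lend u 0 < x < rend u 0 -> derivable u x 1.

Definition supmin_conv (R : realType) (u v : R -> R) (x : R) : R :=
  sup (range (fun y => Num.min (u y) (v (x - y)))).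

Definition smoother (R : realType) (u v : R -> R) : Prop :=
  [/\ fuzzy_number u, fuzzyD v & fuzzyD (supmin_conv u v)].

(* The one-sided derivative of f at x exists (in R) and is equal to l. *)
Definition is_left_derive (R : realType) (f : R -> R) (x l : R) : Prop :=
  (f (x + h) - f x) / h @[h --> 0^'-] --> l.
Definition is_right_derive (R : realType) (f : R -> R) (x l : R) : Prop :=
  (f (x + h) - f x) / h @[h --> 0^'+] --> l.

(* Main.v *)
(** On the left slopes of [u] and [w], any [z] between the left ends of the
supports and the left ends of the cores of the convolution [f] splits as
[z = x + y] with [u x = w y], and then [f z] is this common value; hypothesis
(i) makes such a splitting possible from the lowest point on.  When [z] moves,
[x] and [y] can be chosen to move in the same direction, so their increments
are dominated by that of [z].  Hence [f] inherits continuity from [u], and has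
derivative 0 at [z] as soon as [u] does at [x] or [w] does at [y]; if the
derivatives are [d] at [x] and [d' > 0] at [y], then that of [f] is
[d d' / (d + d')].  If [u] is not differentiable at [x], (ii) and (iv) force
derivative 0 of [w] at [y].  The right slopes follow by the reflection
[x |-> - x], and between the slopes [f] is constant. *)

Require Import Defs.
From HB Require Import structures.
From mathcomp Require Import all_boot all_order all_algebra.
From mathcomp Require Import all_classical all_reals all_analysis.
From mathcomp Require Import ring lra.
Import Order.TTheory GRing.Theory Num.Theory.
Import numFieldNormedType.Exports.
Local Open Scope classical_set_scope.
Local Open Scope ring_scope.

Set Implicit Arguments.
Unset Strict Implicit.

(** * Continuity and differentiability relative to an interval *)

Lemma near_distP (R : realType) (x : R) (P : R -> Prop) :
  (\forall y \near x, P y) <->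
  exists2 d : R, 0 < d & forall y, `|y - x| < d -> P y.
Proof.
split=> [/nbhs_ballP [d d0 dP]|[d d0 dP]].
  by exists d => // y yx; apply: dP; rewrite /ball /= distrC.
by apply/nbhs_ballP; exists d => // y; rewrite /ball /= distrC => /dP.
Qed.

Lemma within_itv_continuousP (R : realType) (f : R -> R) (a b : R) :
  {within `[a, b], continuous f} <->
  forall x e : R, a <= x <= b -> 0 < e ->
    \forall y \near x, a <= y <= b -> `|f y - f x| <= e.
Proof.
rewrite subspace_continuousP; split=> [fc x e xab e0|fc x].
  have /cvgrPdist_le/(_ _ e0) : f y @[y --> within `[a, b] (nbhs x)] --> f x.
    by apply: fc; rewrite /= in_itv.
  rewrite near_withinE.
  move=> H; apply: filterS H => y fy yab.
  by rewrite distrC fy//= in_itv.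
rewrite /= in_itv /= => xab; apply/cvgrPdist_le => e e0.
rewrite near_withinE.
by apply: filterS (fc x e xab e0) => y fy; rewrite /= in_itv /= distrC => /fy.
Qed.

(* [d] is the derivative of [f] at [x] relative to the interval [[a, b]]; it
   is one-sided when [x] is an endpoint. *)
Definition diff_within (R : realType) (f : R -> R) (a b x d : R) : Prop :=
  forall e, 0 < e -> \forall y \near x, a <= y <= b ->
    `|f y - f x - d * (y - x)| <= e * `|y - x|.

Lemma diff_withinW (R : realType) (f : R -> R) (a b a' b' x d : R) :
  a <= a' -> b' <= b -> diff_within f a b x d -> diff_within f a' b' x d.
Proof.
move=> aa' bb' fd e e0; apply: filterS (fd e e0) => y + yab.
by apply; lra.
Qed.

Lemma diff_within_cat (R : realType) (f : R -> R) (a b x d : R) :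
  diff_within f a x x d -> diff_within f x b x d -> diff_within f a b x d.
Proof.
move=> fl fr e e0; apply: filterS2 (fl e e0) (fr e e0) => y yl yr yab.
by have [yx|xy] := leP y x; [apply: yl | apply: yr]; lra.
Qed.

(** Multiplying by [|h|] trades difference quotients for the division-free estimate of
    [diff_within], which is also meaningful at [h = 0]. *)
Lemma slope_distE (R : realType) (D d h e : R) : h != 0 ->
  (`|d - D / h| <= e) = (`|D - d * h| <= e * `|h|).
Proof.
move=> h0; rewrite -(ler_pM2r (_ : 0 < `|h|)) ?normr_gt0// -normrM.
by rewrite mulrBl divfK// distrC.
Qed.

Lemma diff_within_derivable (R : realType) (f : R -> R) (a b x d : R) :
  a < x < b -> diff_within f a b x d -> derivable f x 1.
Proof.
move=> xab fd; apply/cvg_ex; exists d; apply/cvgrPdist_le => e e0.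
(* Since [x] is interior, a full neighbourhood of it lies in the interval, so the relative
   derivative is two-sided. *)
have : \forall y \near x, a < y < b.
  have [ax xb] := andP xab.
  by apply: filterS2 (lt_nbhsr ax) (lt_nbhsl xb) => y -> ->.
move/(filterS2 _ _)/(_ (fd e e0)) => /(_ _ (fun=> _)) H.
have /near_distP[r r0 rP] : \forall y \near x,
    `|f y - f x - d * (y - x)| <= e * `|y - x|.
  by apply: H => y yab; apply; lra.
apply/near_distP; exists r => // h; rewrite subr0 => hr h0.
have {rP} := rP (h + x); rewrite addrK => /(_ hr) H1.
rewrite /= /shift /= [h *: 1]mulr1 /GRing.scale /=.
by rewrite [h^-1 * _]mulrC slope_distE.
Qed.

(** A single [d] serves all intervals, so that it can later be restricted to either side of [x]. *)
Lemma derivable_diff_within (R : realType) (f : R -> R) (x : R) :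
  derivable f x 1 -> exists d, forall a b, diff_within f a b x d.
Proof.
move/cvg_ex => [d fd]; exists d => a b e e0.
move/cvgrPdist_le : fd => /(_ e e0) /near_distP[r r0 rP].
apply/near_distP; exists r => // y yr _.
have [->|yx] := eqVneq y x; first by rewrite !subrr mulr0 subr0 normr0 mulr0.
have h0 : y - x != 0 by rewrite subr_eq0.
have := rP (y - x); rewrite subr0 => /(_ yr h0).
rewrite /= /shift /= [(y - x) *: 1]mulr1 subrK /GRing.scale /=.
by rewrite [_^-1 * _]mulrC slope_distE.
Qed.

Lemma right_derive_diff_within (R : realType) (f : R -> R) (b x d : R) :
  is_right_derive f x d -> diff_within f x b x d.
Proof.
move=> fd e e0; move/cvgrPdist_le : fd => /(_ e e0) /near_distP[r r0 rP].
apply/near_distP; exists r => // y yr /andP[xy _].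
have [->|yx] := eqVneq y x; first by rewrite !subrr mulr0 subr0 normr0 mulr0.
have h0 : y - x != 0 by rewrite subr_eq0.
have := rP (y - x); rewrite subr0 => /(_ yr).
rewrite subr_gt0 lt_neqAle eq_sym yx xy => /(_ isT); rewrite [x + (y - x)]addrC subrK.
by rewrite slope_distE.
Qed.

Lemma left_derive_diff_within (R : realType) (f : R -> R) (a x d : R) :
  is_left_derive f x d -> diff_within f a x x d.
Proof.
move=> fd e e0; move/cvgrPdist_le : fd => /(_ e e0) /near_distP[r r0 rP].
apply/near_distP; exists r => // y yr /andP[_ yx'].
have [->|yx] := eqVneq y x; first by rewrite !subrr mulr0 subr0 normr0 mulr0.
have h0 : y - x != 0 by rewrite subr_eq0.
have := rP (y - x); rewrite subr0 => /(_ yr).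
rewrite subr_lt0 lt_neqAle yx yx' => /(_ isT); rewrite [x + (y - x)]addrC subrK.
by rewrite slope_distE.
Qed.

Lemma near_oppP (R : realType) (x : R) (P : R -> Prop) :
  (\forall y \near x, P y) -> \forall y \near - x, P (- y).
Proof.
move=> /near_distP[r r0 rP]; apply/near_distP; exists r => // y yx.
by apply: rP; rewrite -opprD normrN -[x]opprK.
Qed.

Lemma diff_within_opp (R : realType) (f : R -> R) (a b x d : R) :
  diff_within f a b x d ->
  diff_within (f \o -%R) (- b) (- a) (- x) (- d).
Proof.
move=> fd e e0; apply: filterS (near_oppP (fd e e0)) => y yP yab.
rewrite /= !opprK (_ : - d * (y + x) = d * (- y - x)); last lra.
rewrite (_ : `|y + x| = `|- y - x|); last by rewrite -normrN opprD.
by apply: yP; lra.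
Qed.

(** This makes relative derivatives unique. The witness is a step of [r / 2] to the left of [x], or
    to the right if [x = a], clipped to the interval. *)
Lemma exists_near_itv (R : realType) (a b x r : R) :
  a < b -> a <= x <= b -> 0 < r ->
  exists y, [/\ a <= y <= b, y != x & `|y - x| < r].
Proof.
move=> ab xab r0; have [ax|xa] := ltP a x.
  exists (Num.max a (x - r / 2)).
  by rewrite ltr_norml; case: (leP a (x - r / 2)) => H; split; lra.
exists (Num.min b (x + r / 2)).
by rewrite ltr_norml; case: (leP b (x + r / 2)) => H; split; lra.
Qed.

Lemma diff_within_unique (R : realType) (f : R -> R) (a b x d d' : R) :
  a < b -> a <= x <= b ->
  diff_within f a b x d -> diff_within f a b x d' -> d = d'.
Proof.
move=> ab xab fd fd'; apply/eqP; apply/negPn/negP => dd'.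
(* The two estimates together give [|d - d'| * |y - x| <= 2 * e * |y - x|], which is absurd once
   [2 * e < |d - d'|]. *)
have e0 : 0 < `|d - d'| / 3 by rewrite divr_gt0// normr_gt0 subr_eq0.
have [r r0 rP] := (near_distP _ _).1 (filterI (fd _ e0) (fd' _ e0)).
have [y [yab yx /rP[/(_ yab) H /(_ yab) H']]] := exists_near_itv ab xab r0.
have yx0 : 0 < `|y - x| by rewrite normr_gt0 subr_eq0.
have := ler_normB (f y - f x - d' * (y - x)) (f y - f x - d * (y - x)).
rewrite (_ : _ - _ - (_ - _) = (d - d') * (y - x)); last lra.
rewrite normrM => H2; suff : `|d - d'| * `|y - x| <= 0.
  by rewrite leNgt mulr_gt0// normr_gt0 subr_eq0.
lra.
Qed.

Lemma diff_within_cst (R : realType) (f : R -> R) (a b x : R) :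
  (forall y, a <= y <= b -> f y = f x) -> diff_within f a b x 0.
Proof.
move=> fx e e0; near=> y => yab.
by rewrite fx// mul0r subr0 subrr normr0 mulr_ge0// ltW.
Unshelve. all: by end_near. Qed.

Lemma diff_within_ge0 (R : realType) (f : R -> R) (a x d : R) :
  a < x -> (forall y, a <= y <= x -> f y <= f x) ->
  diff_within f a x x d -> 0 <= d.
Proof.
move=> ax fx fd; rewrite leNgt; apply/negP => d0.
(* With this [e], a point [y < x] close to [x] has [f y - f x >= (- d / 2) * (x - y) > 0]. *)
have e0 : 0 < - d / 2 by lra.
have [r r0 rP] := (near_distP _ _).1 (fd _ e0).
have xax : a <= x <= x by lra.
have [y [yax yx yr]] := exists_near_itv ax xax r0.
have {rP} := rP y yr yax; rewrite ler_norml => /andP[+ _].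
have xy : y < x by rewrite lt_neqAle yx; lra.
rewrite ltr0_norm ?subr_lt0//; have := fx _ yax; nra.
Qed.

(** * The sup-min convolution and balanced splittings *)

Lemma supmin_conv_max (R : realType) (u w : R -> R) (z x : R) :
  (forall y, Num.min (u y) (w (z - y)) <= Num.min (u x) (w (z - x))) ->
  supmin_conv u w z = Num.min (u x) (w (z - x)).
Proof.
move=> ub; apply/eqP; rewrite eq_le; apply/andP; split.
  by apply: ge_sup => [|_ [y _ <-]]; [exists (Num.min (u x) (w (z - x))), x|].
apply: ub_le_sup; last by exists x.
by exists (Num.min (u x) (w (z - x))) => _ [y _ <-].
Qed.

Lemma supmin_conv_opp (R : realType) (u w : R -> R) :
  supmin_conv (u \o -%R) (w \o -%R) = supmin_conv u w \o -%R.
Proof.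
apply/funext => z; rewrite /supmin_conv /=; congr sup; apply/seteqP.
by split=> _ [y _ <-]; exists (- y) => //=; rewrite ?opprK !opprD ?opprK.
Qed.

(** The intermediate value theorem for [u x - w (z - x)] on [[s, t]], the set of [x] for which [x]
    and [z - x] lie in their intervals. At [s] either [x = x0] or [z - x = y1], so monotonicity and
    the matching end values make the difference nonpositive; dually it is nonnegative at [t]. *)
Lemma balanced_split (R : realType) (u w : R -> R) (x0 x1 y0 y1 z : R) :
  x0 <= x1 -> y0 <= y1 -> x0 + y0 <= z <= x1 + y1 ->
  {within `[x0, x1], continuous u} -> {within `[y0, y1], continuous w} ->
  (forall x y, x <= y -> y <= x1 -> u x <= u y) ->
  (forall x y, x <= y -> y <= y1 -> w x <= w y) ->
  u x0 = w y0 -> u x1 = w y1 ->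
  exists x, [/\ x0 <= x <= x1, y0 <= z - x <= y1 & u x = w (z - x)].
Proof.
move=> x01 y01 zb /within_itv_continuousP uc /within_itv_continuousP wc um wm.
move=> uw0 uw1; pose s := Num.max x0 (z - y1); pose t := Num.min x1 (z - y0).
have st : [/\ s <= t, x0 <= s, z - y1 <= s, t <= x1 & t <= z - y0].
  rewrite /s /t; case: (leP x0 (z - y1)) => ?; case: (leP x1 (z - y0)) => ?;
  split; lra.
have [st1 st2 st3 st4 st5] := st.
have fc : {within `[s, t], continuous (fun x => u x - w (z - x))}.
  apply/within_itv_continuousP => x e xst e0.
  have e20 : 0 < e / 2 by lra.
  have xx : x0 <= x <= x1 by lra.
  have yy : y0 <= z - x <= y1 by lra.
  have [r r0 rP] := (near_distP _ _).1 (uc _ _ xx e20).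
  have [q q0 qP] := (near_distP _ _).1 (wc _ _ yy e20).
  apply/near_distP; exists (Num.min r q); first by rewrite lt_min r0.
  move=> y; rewrite lt_min => /andP[yr yq] yst.
  have H1 := rP y yr (ltac:(lra)).
  have H2 : `|w (z - y) - w (z - x)| <= e / 2.
    apply: qP; last lra.
    by rewrite (_ : z - y - (z - x) = - (y - x)) ?normrN//; lra.
  move: H1 H2; rewrite !ler_norml; lra.
have us : u s - w (z - s) <= 0.
  rewrite subr_le0 /s; case: (leP x0 (z - y1)) => [H|H].
    by rewrite (_ : z - (z - y1) = y1) ?uw1; last lra; rewrite -uw1; apply: um; lra.
  by rewrite uw0; apply: wm; lra.
have ut : 0 <= u t - w (z - t).
  rewrite subr_ge0 /t; case: (leP x1 (z - y0)) => [H|H].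
    by rewrite uw1; apply: wm; lra.
  by rewrite (_ : z - (z - y0) = y0); last lra; rewrite -uw0; apply: um; lra.
have := IVT st1 fc (v := 0); rewrite ge_min us le_max ut orbT => /(_ isT).
move=> [x]; rewrite in_itv /= => xst /eqP; rewrite subr_eq0 => /eqP uwx.
by exists x; split=> //; lra.
Qed.

(** * Left slopes and their coupled points *)

(* The left half of a fuzzy number in [fuzzyC] with [lend u 0 = a] and
   [lend u 1 = p]; the right half is the left half of [u \o -%R]. *)
Record rising (R : realType) (u : R -> R) (a p : R) : Prop := Rising {
  rising_le : a <= p;
  rising_mono : forall x y, x <= y -> y <= p -> u x <= u y;
  rising_itv : forall x, 0 <= u x <= 1;
  rising_top : u p = 1;
  rising_lt1 : forall x, x < p -> u x < 1;
  rising_out : forall x, x < a -> u x = 0;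
  rising_gt0 : forall x, a < x <= p -> 0 < u x;
  rising_cont : {within `[a, p], continuous u} }.

(** Any two points of equal height are paired, not only the left ends of level sets: these ends jump
    over flat pieces, and their sums would miss some [z]. *)
Definition coupled (R : realType) (u : R -> R) (a p : R) (w : R -> R)
  (a' p' x y : R) : Prop := [/\ a <= x <= p, a' <= y <= p' & u x = w y].

Lemma coupled_bot (R : realType) (u w : R -> R) (a p a' p' : R) :
  rising u a p -> rising w a' p' -> u a = w a' -> coupled u a p w a' p' a a'.
Proof.
by move=> ru rw uw; split=> //; rewrite lexx ?(rising_le ru) ?(rising_le rw).
Qed.

Lemma coupled_top (R : realType) (u w : R -> R) (a p a' p' : R) :
  rising u a p -> rising w a' p' -> coupled u a p w a' p' p p'.
Proof.
by move=> ru rw; split; rewrite ?lexx ?andbT ?(rising_le ru) ?(rising_le rw)//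
  (rising_top ru) (rising_top rw).
Qed.

(** The balanced splitting is optimal: a splitting point [v] to the left of [x] has [u v <= u x],
    and one to the right has [w (x + y - v) <= w y]. *)
Lemma coupled_supmin (R : realType) (u w : R -> R) (a p a' p' x y : R) :
  rising u a p -> rising w a' p' -> coupled u a p w a' p' x y ->
  supmin_conv u w (x + y) = u x.
Proof.
move=> ru rw [/andP[ax xp] /andP[ay yp] uwxy].
have xyx : x + y - x = y by rewrite addrC addKr.
rewrite (@supmin_conv_max _ _ _ _ x) xyx -uwxy minxx// => v.
rewrite ge_min; have [vx|xv] := leP v x; first by rewrite (rising_mono ru).
by rewrite uwxy (rising_mono rw) ?orbT//; lra.
Qed.

Lemma coupled_between (R : realType) (u w : R -> R) (a p a' p' x0 y0 x1 y1 z : R) :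
  rising u a p -> rising w a' p' ->
  coupled u a p w a' p' x0 y0 -> coupled u a p w a' p' x1 y1 ->
  x0 <= x1 -> y0 <= y1 -> x0 + y0 <= z <= x1 + y1 ->
  exists x y, [/\ coupled u a p w a' p' x y, x0 <= x <= x1, y0 <= y <= y1 &
    x + y = z].
Proof.
move=> ru rw [c1 c2 c3] [d1 d2 d3] x01 y01 zb.
have [] := @balanced_split _ u w x0 x1 y0 y1 z => //.
- apply: continuous_subspaceW (rising_cont ru) => t /=.
  by rewrite !in_itv /=; lra.
- apply: continuous_subspaceW (rising_cont rw) => t /=.
  by rewrite !in_itv /=; lra.
- by move=> x y xy yx; apply: (rising_mono ru) => //; lra.
- by move=> x y xy yx; apply: (rising_mono rw) => //; lra.
- by move=> x [? ? ?]; exists x, (z - x); split=> //; [split=> //; lra|lra].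
Qed.

Lemma coupled_exists (R : realType) (u w : R -> R) (a p a' p' z : R) :
  rising u a p -> rising w a' p' -> u a = w a' -> a + a' <= z <= p + p' ->
  exists x y, coupled u a p w a' p' x y /\ x + y = z.
Proof.
move=> ru rw uw zb.
have [x [y [c _ _ <-]]] := coupled_between ru rw (coupled_bot ru rw uw)
  (coupled_top ru rw) (rising_le ru) (rising_le rw) zb.
by exists x, y.
Qed.

(** The new pair is taken between the given one and the bottom or the top pair. Both increments then
    have the sign of [z - (x + y)] and add up to it, so neither exceeds it in absolute value. *)
Lemma coupled_coherent (R : realType) (u w : R -> R) (a p a' p' x y z : R) :
  rising u a p -> rising w a' p' -> u a = w a' ->
  coupled u a p w a' p' x y -> a + a' <= z <= p + p' ->
  exists x' y', [/\ coupled u a p w a' p' x' y', x' + y' = z,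
    `|x' - x| <= `|z - (x + y)| & `|y' - y| <= `|z - (x + y)|].
Proof.
move=> ru rw uw c zb; have [/andP[ax xp] /andP[ay yp] _] := c.
have [zxy|xyz] := leP z (x + y).
  have [|x' [y' [c' H1 H2 H3]]] := coupled_between ru rw
    (coupled_bot ru rw uw) c ax ay (z := z); first by lra.
  exists x', y'; split=> //; rewrite !ler0_norm; lra.
have [|x' [y' [c' H1 H2 H3]]] := coupled_between ru rw
  c (coupled_top ru rw) xp yp (z := z); first by lra.
exists x', y'; split=> //; rewrite !ger0_norm; lra.
Qed.

Lemma rising_supmin (R : realType) (u w : R -> R) (a p a' p' : R) :
  rising u a p -> rising w a' p' -> u a = w a' ->
  rising (supmin_conv u w) (a + a') (p + p').
Proof.
move=> ru rw uw.
have ap := rising_le ru; have ap' := rising_le rw.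
have f0 x : x < a + a' -> supmin_conv u w x = 0.
  (* At [a - 1], as at any point below [a], the minimum is 0. No splitting does better: [x < a + a']
     forces [y < a] or [x - y < a']. *)
  move=> xa; rewrite (@supmin_conv_max _ _ _ _ (a - 1)).
    rewrite (rising_out ru) ?min_l//; last lra.
    by have /andP[] := rising_itv rw (x - (a - 1)).
  move=> y; rewrite (rising_out ru (_ : a - 1 < a)); last lra.
  rewrite [leRHS]min_l; last by have /andP[] := rising_itv rw (x - (a - 1)).
  rewrite ge_min; have [ya|ay] := ltP y a; first by rewrite (rising_out ru) ?lexx.
  by rewrite (rising_out rw (_ : x - y < a')) ?lexx ?orbT//; lra.
have f01 x : 0 <= supmin_conv u w x <= 1.
  have ub : has_ubound (range (fun y => Num.min (u y) (w (x - y)))).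
    exists 1 => _ [y _ <-]; rewrite ge_min.
    by have /andP[_ ->] := rising_itv ru y.
  apply/andP; split.
    apply: (@le_trans _ _ (Num.min (u 0) (w (x - 0)))).
      by rewrite le_min (andP (rising_itv ru _)).1 (andP (rising_itv rw _)).1.
    by apply: ub_le_sup => //; exists 0.
  apply: ge_sup; first by exists (Num.min (u 0) (w (x - 0))), 0.
  move=> _ [y _ <-]; rewrite ge_min.
  by have /andP[_ ->] := rising_itv ru y.
split=> //.
- by lra.
- move=> s t st tp; have [sa|sa] := ltP s (a + a').
    by rewrite f0//; have /andP[] := f01 t.
  have [|x [y [c xys]]] := coupled_exists ru rw uw (z := s); first lra.
  have [/andP[_ xp] /andP[_ yp] _] := c.
  (* Choosing the pair for [t] between the pair for [s] and the top gives [x <= x']. *)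
  have [|x' [y' [c' H1 H2 xyt]]] :=
    coupled_between ru rw c (coupled_top ru rw) xp yp (z := t); first lra.
  rewrite -xys -xyt !(coupled_supmin ru rw)//; apply: (rising_mono ru); first lra.
  by case: c'; lra.
- by rewrite (coupled_supmin ru rw (coupled_top ru rw)) (rising_top ru).
- move=> z zp; have [za|za] := ltP z (a + a'); first by rewrite f0.
  have [|x [y [c xyz]]] := coupled_exists ru rw uw (z := z); first lra.
  rewrite -xyz (coupled_supmin ru rw)//; have [xp yp uwxy] := c.
  have [?|?] := ltP x p; first exact: (rising_lt1 ru).
  by rewrite uwxy; apply: (rising_lt1 rw); lra.
- move=> z zap; have [|x [y [c xyz]]] := coupled_exists ru rw uw (z := z); first lra.
  rewrite -xyz (coupled_supmin ru rw)//; have [xp yp uwxy] := c.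
  have [?|?] := ltP a x; first by apply: (rising_gt0 ru); lra.
  by rewrite uwxy; apply: (rising_gt0 rw); lra.
- apply/within_itv_continuousP => z e zap e0.
  have [x [y [c xyz]]] := coupled_exists ru rw uw zap.
  have [xap _ _] := c.
  have /within_itv_continuousP/(_ _ _ xap e0) := rising_cont ru.
  move=> /near_distP[r r0 rP]; apply/near_distP; exists r => // t tr tap.
  (* As [x'] is no farther from [x] than [t] from [z], the radius found for [u] at [x] serves the
     convolution at [z]. *)
  have [x' [y' [c' xyt Hx _]]] := coupled_coherent ru rw uw c tap.
  rewrite -xyt -xyz !(coupled_supmin ru rw)//; apply: rP; last by case: c'.
  by apply: le_lt_trans Hx _; rewrite xyz.
Qed.

(** * Derivatives of the convolution along left slopes *)

Lemma diff_within_flat (R : realType) (f : R -> R) (a b c x d : R) :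
  a <= c < x -> x <= b -> (forall y, c <= y <= x -> f y = f x) ->
  diff_within f a b x d -> d = 0.
Proof.
move=> acx xb fx fd; apply: (@diff_within_unique _ f c x x) => //; try lra.
  by apply: diff_withinW fd; lra.
exact: diff_within_cst.
Qed.

(** Along coherent pairs the increment of the convolution equals both that of [u] and that of [w],
    while neither argument moves more than [z]. So a little-o bound for either function passes to
    the convolution. *)
Lemma diff_supmin0 (R : realType) (u w : R -> R) (a p a' p' x y : R) :
  rising u a p -> rising w a' p' -> u a = w a' ->
  coupled u a p w a' p' x y ->
  diff_within u a p x 0 \/ diff_within w a' p' y 0 ->
  diff_within (supmin_conv u w) (a + a') (p + p') (x + y) 0.
Proof.
move=> ru rw uw c [ud|wd] e e0.
- have [r r0 rP] := (near_distP _ _).1 (ud e e0).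
  apply/near_distP; exists r => // z zr zap.
  have [s [t [c' stz H _]]] := coupled_coherent ru rw uw c zap.
  rewrite -{1}stz !(coupled_supmin ru rw)//.
  have [sap _ _] := c'.
  have := rP s (le_lt_trans H zr) sap; rewrite !mul0r => /le_trans; apply.
  by rewrite ler_pM2l.
- have [r r0 rP] := (near_distP _ _).1 (wd e e0).
  apply/near_distP; exists r => // z zr zap.
  have [s [t [c' stz _ H]]] := coupled_coherent ru rw uw c zap.
  rewrite -{1}stz !(coupled_supmin ru rw)//.
  have [[_ _ ->] [_ tap ->]] := (c, c').
  have := rP t (le_lt_trans H zr) tap; rewrite !mul0r => /le_trans; apply.
  by rewrite ler_pM2l.
Qed.

(** For a common increment [D] with [D ~ d * (s - x)] and [D ~ d' * (t - y)], averaging the two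
    relations with weights [d'] and [d] leaves [d * d' * h / (d + d')], because the arguments'
    increments add up to [h]. Being an average, this keeps the error below [e * |h|]; it also covers
    [d = 0]. *)
Lemma diff_supmin (R : realType) (u w : R -> R) (a p a' p' x y d d' : R) :
  rising u a p -> rising w a' p' -> u a = w a' ->
  coupled u a p w a' p' x y ->
  0 <= d -> 0 < d' -> diff_within u a p x d -> diff_within w a' p' y d' ->
  diff_within (supmin_conv u w) (a + a') (p + p') (x + y) (d * d' / (d + d')).
Proof.
move=> ru rw uw c d0 d0' ud wd e e0.
have [r r0 rP] := (near_distP _ _).1 (ud e e0).
have [q q0 qP] := (near_distP _ _).1 (wd e e0).
apply/near_distP; exists (Num.min r q); first by rewrite lt_min r0.
move=> z; rewrite lt_min => /andP[zr zq] zap.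
have [s [t [c' stz H H']]] := coupled_coherent ru rw uw c zap.
have [[_ _ uwc] [sap tap uwc']] := (c, c').
rewrite -{1}stz !(coupled_supmin ru rw)//.
have E1 := rP s (le_lt_trans H zr) sap.
have := qP t (le_lt_trans H' zq) tap; rewrite -uwc -uwc' => E2.
set D := u s - u x in E1 E2 *; set h := z - (x + y) in H H' *.
have dd : 0 < d + d' by lra.
have dd0 : d + d' != 0 by rewrite gt_eqF.
have -> : D - d * d' / (d + d') * h =
    (d' * (D - d * (s - x)) + d * (D - d' * (t - y))) / (d + d').
  apply: (mulIf dd0); rewrite mulfVK// mulrBl mulrAC mulfVK//.
  rewrite /h -stz; ring.
rewrite normrM normfV (gtr0_norm dd) ler_pdivrMr//.
apply: le_trans (ler_normD _ _) _.
rewrite !normrM (ger0_norm d0) (gtr0_norm d0').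
have F1 : d' * `|D - d * (s - x)| <= d' * (e * `|h|).
  by rewrite ler_pM2l//; apply: le_trans E1 _; rewrite ler_pM2l.
have F2 : d * `|D - d' * (t - y)| <= d * (e * `|h|).
  by rewrite ler_wpM2l//; apply: le_trans E2 _; rewrite ler_pM2l.
lra.
Qed.

(** The second alternative for [u] at [x] is hypothesis (iv-1), with [lend w (u x)] described as the
    least point of its height instead of through level sets. *)
Lemma diff_supmin_exists (R : realType) (u w : R -> R) (a p a' p' z : R) :
  rising u a p -> rising w a' p' -> u a = w a' ->
  (forall y, a' < y < p' -> exists d, diff_within w a' p' y d) ->
  (forall x, a < x < p -> (exists d, diff_within u a p x d) \/
     forall y, a' <= y < p' -> w y = u x -> (forall y', y' < y -> w y' < w y) ->
       diff_within w y p' y 0) ->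
  a + a' < z < p + p' ->
  exists d, diff_within (supmin_conv u w) (a + a') (p + p') z d.
Proof.
move=> ru rw uw wd ud zap.
have [|x [y [c xyz]]] := coupled_exists ru rw uw (z := z); first lra.
have [xap yap uwxy] := c.
have z1 : u x < 1.
  rewrite -(coupled_supmin ru rw c) xyz; apply: (rising_lt1 (rising_supmin ru rw uw)).
  by lra.
have xp : x < p.
  rewrite ltNge; apply/negP => px; have xp : x = p by lra.
  by move: z1; rewrite xp (rising_top ru) ltxx.
have yp : y < p'.
  rewrite ltNge; apply/negP => py; have yp : y = p' by lra.
  by move: z1; rewrite uwxy yp (rising_top rw) ltxx.
have flat0 : diff_within u a p x 0 \/ diff_within w a' p' y 0 ->
    exists d, diff_within (supmin_conv u w) (a + a') (p + p') z d.
  by rewrite -xyz => H; exists 0; apply: diff_supmin0.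
(* At [y = a'] nothing is assumed on the derivative of [w]. There [u x = w a' = u a], so [u] is flat
   on [[a, x]] and any derivative at [x] is 0. If there is none, [a'] is the least point of its
   height, since [w] vanishes below it and [0 < u x]. *)
have [ay|ya] := ltP a' y; last first.
  have ya' : y = a' by lra.
  have ax : a < x by lra.
  have [|[d xd]|wflat] := ud x; first lra.
    apply: flat0; left; suff <- : d = 0 by [].
    apply: (diff_within_flat (c := a) _ _ _ xd); [lra|lra|move=> t tax].
    apply/eqP; rewrite eq_le (rising_mono ru)//=; try lra.
    by rewrite uwxy ya' -uw (rising_mono ru)//; lra.
  apply: flat0; right; rewrite ya'; apply: wflat; [lra|by rewrite -ya'|].
  move=> y' y'a; rewrite (rising_out rw)// -ya' -uwxy (rising_gt0 ru)//; lra.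
have [|d' yd] := wd y; first lra.
have wmono t : a' <= t <= y -> w t <= w y.
  by move=> ty; apply: (rising_mono rw); lra.
have d'0 : 0 <= d'.
  by apply: (diff_within_ge0 ay wmono (diff_withinW _ _ yd)); lra.
have [d'z|d'nz] := eqVneq d' 0; first by apply: flat0; right; rewrite -d'z.
(* Otherwise [w] would be constant just to the left of [y], forcing [d' = 0]. *)
have yleast y' : y' < y -> w y' < w y.
  move=> y'y; rewrite ltNge; apply/negP => wyy'; move/eqP: d'nz; apply.
  apply: (diff_within_flat (c := Num.max a' y') _ _ _ yd).
  - by rewrite le_max lexx gt_max ay.
  - lra.
  - move=> t; rewrite ge_max => /andP[/andP[a't y't] ty].
    apply/eqP; rewrite eq_le wmono ?a't//=.
    by apply: le_trans wyy' _; apply: (rising_mono rw) => //; lra.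
have [ax|xa] := ltP a x; last first.
  have xa' : x = a by lra.
  by have := yleast _ ay; rewrite -uwxy xa' uw ltxx.
have [|[d xd]|wflat] := ud x; first lra.
  exists (d * d' / (d + d')); rewrite -xyz; apply: diff_supmin => //.
    apply: (diff_within_ge0 ax _ (diff_withinW _ _ xd)); try lra.
    by move=> t tax; apply: (rising_mono ru); lra.
  by rewrite lt_neqAle eq_sym d'nz.
(* If [u] is not differentiable at [x], the right derivative 0 of [w] at [y] contradicts
   [d' != 0]. *)
have yd0 : diff_within w y p' y 0 by apply: wflat => //; lra.
case/eqP: d'nz; apply: (diff_within_unique yp _ _ yd0); first lra.
by apply: diff_withinW yd; lra.
Qed.

(** * Level sets, their endpoints and reflection *)

Lemma closure_distP (R : realType) (S : set R) (x : R) :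
  closure S x <-> forall r, 0 < r -> exists2 y, S y & `|y - x| < r.
Proof.
split=> [cx r r0|H B /near_distP[r r0 rB]].
  have : \forall y \near x, `|y - x| < r by apply/near_distP; exists r.
  by move=> /cx [y [Sy yr]]; exists y.
by have [y Sy /rB By] := H _ r0; exists y.
Qed.

Lemma level0E (R : realType) (u : R -> R) : level u 0 = closure [set x | 0 < u x].
Proof. by rewrite /level eqxx. Qed.

Lemma level_gt0E (R : realType) (u : R -> R) (t : R) :
  0 < t -> level u t = [set x | t <= u x].
Proof. by move=> t0; rewrite /level gt_eqF. Qed.

Lemma lend_eq (R : realType) (u : R -> R) (t l r : R) :
  l <= r -> level u t = `[l, r]%classic -> lend u t = l.
Proof. by move=> lr; rewrite /lend => ->; rewrite inf_itv// bnd_simp. Qed.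

Lemma rend_eq (R : realType) (u : R -> R) (t l r : R) :
  l <= r -> level u t = `[l, r]%classic -> rend u t = r.
Proof. by move=> lr; rewrite /rend => ->; rewrite sup_itv// bnd_simp. Qed.

Lemma le_lend_rend (R : realType) (u : R -> R) (t : R) :
  fuzzy_number u -> 0 <= t <= 1 -> lend u t <= rend u t.
Proof.
move=> [_ _ H] t01; have [l [r [lr E]]] := H _ t01.
by rewrite (lend_eq lr E) (rend_eq lr E).
Qed.

Lemma level_opp (R : realType) (u : R -> R) (t : R) :
  level (u \o -%R) t = [set x | level u t (- x)].
Proof.
rewrite /level; case: eqP => [_|//]; apply/seteqP; split=> x /closure_distP H.
  apply/closure_distP => r r0; have [y uy yx] := H _ r0.
  by exists (- y) => //; rewrite -opprD normrN.
apply/closure_distP => r r0; have [y uy yx] := H _ r0.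
by exists (- y); rewrite /= ?opprK// -opprD normrN -[x]opprK.
Qed.

Lemma opp_itv_preimage (R : realType) (l r : R) :
  [set x | `[l, r]%classic (- x)] = `[- r, - l]%classic.
Proof.
by apply/seteqP; split=> x /=; rewrite !in_itv /=; lra.
Qed.

Lemma lend_opp (R : realType) (u : R -> R) (t : R) :
  fuzzy_number u -> 0 <= t <= 1 -> lend (u \o -%R) t = - rend u t.
Proof.
move=> uf t01; apply: (@lend_eq _ _ _ _ (- lend u t)).
  by rewrite lerN2 le_lend_rend.
by rewrite level_opp (fuzzy_levelE uf t01) opp_itv_preimage.
Qed.

Lemma rend_opp (R : realType) (u : R -> R) (t : R) :
  fuzzy_number u -> 0 <= t <= 1 -> rend (u \o -%R) t = - lend u t.
Proof.
move=> uf t01; apply: (@rend_eq _ _ _ (- rend u t)).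
  by rewrite lerN2 le_lend_rend.
by rewrite level_opp (fuzzy_levelE uf t01) opp_itv_preimage.
Qed.

Lemma fuzzyC_opp (R : realType) (u : R -> R) :
  fuzzyC u -> fuzzyC (u \o -%R).
Proof.
move=> [uf uc]; have [u01 [x ux] ul] := uf.
have t0 : 0 <= (0 : R) <= 1 by rewrite lexx ler01.
split; first split.
- by move=> y; exact: u01.
- by exists (- x); rewrite level_opp /= opprK.
- move=> t t01; have [l [r [lr E]]] := ul _ t01.
  by exists (- r), (- l); rewrite lerN2 level_opp E opp_itv_preimage.
rewrite level_opp (fuzzy_levelE uf t0) opp_itv_preimage.
apply: within_continuous_compN; rewrite !opprK.
by rewrite -(fuzzy_levelE uf t0).
Qed.

Lemma mem_level (R : realType) (u : R -> R) (t x : R) :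
  fuzzy_number u -> 0 <= t <= 1 -> level u t x <-> lend u t <= x <= rend u t.
Proof. by move=> uf t01; rewrite (fuzzy_levelE uf t01)/= in_itv. Qed.

Lemma ge_level (R : realType) (u : R -> R) (t x : R) :
  fuzzy_number u -> 0 < t <= 1 -> (t <= u x) = (lend u t <= x <= rend u t).
Proof.
move=> uf t01; have t0 : 0 < t by lra.
have := @mem_level _ u t x uf (ltac:(lra)); rewrite level_gt0E//= => E.
by apply/idP/idP => /E.
Qed.

Lemma gt0_level (R : realType) (u : R -> R) (x : R) :
  fuzzy_number u -> 0 < u x -> lend u 0 <= x <= rend u 0.
Proof.
move=> uf ux; apply/(mem_level _ uf); first by rewrite lexx ler01.
by rewrite level0E; apply: subset_closure.
Qed.

(** For [0 < t] this is convexity of [level u t]. The case [t <= 0] is nonnegativity of [u], because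
    [level u 0] is a closure and not a superlevel set. *)
Lemma quasiconcave (R : realType) (u : R -> R) (t x y z : R) :
  fuzzy_number u -> x <= y <= z -> t <= u x -> t <= u z -> t <= u y.
Proof.
move=> uf xyz tx tz; have [/(_ y) /andP[y0 _] _ _] := uf.
have [t0|t0] := leP t 0; first exact: le_trans y0.
have [/(_ x) ux1 _ _] := uf.
have t01 : 0 < t <= 1 by lra.
by move: tx tz; rewrite !(ge_level _ uf t01); lra.
Qed.

(** * Passing between fuzzy numbers and their slopes *)

Lemma fuzzyC_rising (R : realType) (u : R -> R) :
  fuzzyC u -> rising u (lend u 0) (lend u 1).
Proof.
move=> [uf uc]; have [u01 _ _] := uf.
have I0 : 0 <= (0 : R) <= 1 by rewrite lexx ler01.
have I1 : 0 < (1 : R) <= 1 by rewrite lexx ltr01.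
have le1 := @le_lend_rend _ u 1 uf (ltac:(lra)).
have top x : (1 <= u x) = (lend u 1 <= x <= rend u 1) by rewrite (ge_level _ uf I1).
have top1 : 1 <= u (lend u 1) by rewrite top lexx.
have le0 : lend u 0 <= lend u 1 <= rend u 0 by apply: gt0_level => //; lra.
split.
- by lra.
- move=> x y xy y1; apply: (@quasiconcave _ u (u x) x y (lend u 1)) => //.
    by rewrite xy.
  by have := u01 x; lra.
- exact: u01.
- by apply/eqP; rewrite eq_le top1 andbT; have := u01 (lend u 1); lra.
- by move=> x x1; rewrite ltNge top; lra.
- move=> x x0; apply/eqP; rewrite eq_le andbC (andP (u01 x)).1/=.
  by rewrite leNgt; apply/negP => /(gt0_level uf); lra.
(* The end [lend u 0] is a limit of points where [u] is positive; one of them lies to the left of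
   [x], and quasiconcavity carries its positive value to [x]. *)
- move=> x x01; have : level u 0 (lend u 0) by apply/(mem_level _ uf); lra.
  rewrite level0E => /closure_distP/(_ (x - lend u 0)) [|y /= uy].
    by lra.
  rewrite ltr_norml => yx.
  apply: lt_le_trans uy _; apply: (@quasiconcave _ u _ y x (lend u 1)) => //.
    by lra.
  by have := u01 y; lra.
- apply: continuous_subspaceW uc => x; rewrite (fuzzy_levelE uf I0) /= !in_itv /=.
  by lra.
Qed.

(** The point [l] is the infimum of the points of height at least [t]. Continuity shows that [l]
    itself has such a height, and monotonicity extends this up to [p]. *)
Lemma rising_level (R : realType) (f : R -> R) (a p t : R) :
  rising f a p -> 0 < t <= 1 ->
  exists2 l, a <= l <= p & forall x, x <= p -> (t <= f x) = (l <= x).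
Proof.
move=> rf t01; pose S := [set x | x <= p /\ t <= f x].
have Sp : S p by split; rewrite ?lexx// (rising_top rf); lra.
have Sa x : S x -> a <= x.
  by move=> [_ tx]; rewrite leNgt; apply/negP => /(rising_out rf); lra.
have hS : has_inf S by split; [exists p|exists a].
have ainf : a <= inf S by apply: lb_le_inf => //; exists p.
have infp : inf S <= p by apply: ge_inf => //; exists a.
exists (inf S); first by rewrite ainf.
have tinf : t <= f (inf S).
  rewrite leNgt; apply/negP => ft.
  have infap : a <= inf S <= p by rewrite ainf.
  have e0 : 0 < (t - f (inf S)) / 2 by lra.
  have /within_itv_continuousP/(_ _ _ infap e0) := rising_cont rf.
  move=> /near_distP[r r0 rP].
  have [x Sx xr] := inf_adherent r0 hS.
  have infx : inf S <= x by apply: ge_inf => //; exists a.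
  have [xp tx] := Sx; have := rP x _ (ltac:(lra)).
  rewrite ger0_norm ?subr_ge0// => /(_ (ltac:(lra))).
  by rewrite ler_norml; lra.
move=> x xp; apply/idP/idP => [tx|lx]; first by apply: ge_inf => //; exists a.
by apply: le_trans tinf _; apply: (rising_mono rf).
Qed.

(** A step of [r / 2] to the right enters the support; if it reaches [p], then [p] itself is close
    enough, which includes the case [a = p]. *)
Lemma rising_near_gt0 (R : realType) (f : R -> R) (a p x r : R) :
  rising f a p -> a <= x <= p -> 0 < r -> exists2 y, 0 < f y & `|y - x| < r.
Proof.
move=> rf xap r0; have [xr|xr] := leP p (x + r / 2).
  exists p; first by rewrite (rising_top rf) ltr01.
  by rewrite ger0_norm; lra.
exists (x + r / 2); first by apply: (rising_gt0 rf); lra.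
by rewrite ger0_norm; lra.
Qed.

(** A converse of [fuzzyC_rising]: the left ends of the level sets come from the left slope, the
    right ends from the reflected right slope, and the core [[p, q]] joins them. *)
Lemma rising_fuzzyC (R : realType) (f : R -> R) (a p q b : R) :
  rising f a p -> rising (f \o -%R) (- b) (- q) -> p <= q ->
  (forall x, p <= x <= q -> f x = 1) ->
  [/\ fuzzyC f, lend f 0 = a & rend f 0 = b].
Proof.
move=> rf rg pq f1; have ap := rising_le rf; have qb := rising_le rg.
have f0 x : 0 < f x -> a <= x <= b.
  move=> fx; apply/andP; split; rewrite leNgt; apply/negP => H.
    by have := rising_out rf H; lra.
  have H' : - x < - b by lra.
  by have := rising_out rg H'; rewrite /= opprK; lra.
have lev0 : level f 0 = `[a, b]%classic.
  rewrite level0E; apply/seteqP; split=> x.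
    move=> cx; suff : closure `[a, b]%classic x by move/itv_closed.
    by apply: closure_subset cx => y /= /f0; rewrite in_itv.
  rewrite /= in_itv /= => xab; apply/closure_distP => r r0.
  have [xp|px] := leP x p; first by apply: (rising_near_gt0 rf) => //; lra.
  have [xq|qx] := leP x q.
    by exists x; rewrite /= ?f1 ?ltr01 ?subrr ?normr0//; lra.
  have [||y yg yr] := @rising_near_gt0 _ _ _ _ (- x) r rg; [lra|by []|].
  by exists (- y) => //; rewrite -opprD normrN -[x]opprK.
have lev t : 0 < t <= 1 -> exists l r, l <= r /\ level f t = `[l, r]%classic.
  move=> t01; have [l lap lE] := rising_level rf t01.
  have [r rqb rE] := rising_level rg t01.
  exists l, (- r); split; first lra.
  rewrite level_gt0E; last lra.
  apply/seteqP; split=> x; rewrite /= in_itv /=.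
    move=> tx; have [xp|px] := leP x p; first by rewrite lE// in tx; lra.
    have [xq|qx] := leP x q; first by lra.
    have := rE (- x); rewrite /= opprK tx => /(_ (ltac:(lra))) /esym; lra.
  move=> lxr; have [xp|px] := leP x p; first by rewrite lE//; lra.
  have [xq|qx] := leP x q; first by rewrite f1; lra.
  by have := rE (- x); rewrite /= opprK => -> //; lra.
have ab : a <= b by lra.
split; [split|exact: lend_eq lev0|exact: rend_eq lev0].
  split.
  - move=> x; have [xp|px] := leP x p; first exact: (rising_itv rf).
    by have := rising_itv rg (- x); rewrite /= opprK.
  - by exists p; rewrite level_gt0E ?ltr01//= f1 ?lexx.
  - move=> t t01; have [->|t0] := eqVneq t 0; first by exists a, b.
    by apply: lev; rewrite lt_neqAle eq_sym t0.
(* Continuity is pasted from three closed pieces: left slope, core and right slope. *)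
have -> : level f 0 = `[a, p]%classic `|` (`[p, q]%classic `|` `[q, b]%classic).
  rewrite lev0; apply/seteqP; split=> x /=; rewrite !in_itv /=; last lra.
  by move=> xab; case: (leP x p) => ?; case: (leP x q) => ?; lra.
apply: withinU_continuous; [exact: itv_closed| |exact: (rising_cont rf)|].
  by apply: closedU; exact: itv_closed.
apply: withinU_continuous; [exact: itv_closed|exact: itv_closed| |].
  apply/within_itv_continuousP => x e xpq e0; near=> y => ypq.
  by rewrite !f1// subrr normr0 ltW.
have -> : f = (f \o -%R) \o -%R by apply/funext => x; rewrite /= opprK.
by apply: within_continuous_compN; exact: (rising_cont rg).
Unshelve. all: by end_near. Qed.

(** * Reflection of derivatives, maxima and cores *)

Lemma derivable_opp (R : realType) (f : R -> R) (x : R) :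
  derivable f (- x) 1 -> derivable (f \o -%R) x 1.
Proof.
move=> /derivable_diff_within[d fd].
apply: (@diff_within_derivable _ _ (x - 1) (x + 1) x (- d)); first lra.
have := diff_within_opp (fd (- x - 1) (- x + 1)); rewrite opprK.
by apply: diff_withinW; lra.
Qed.

Lemma comp_oppK (R : realType) (f : R -> R) : (f \o -%R) \o -%R = f.
Proof. by apply/funext => x; rewrite /= opprK. Qed.

Lemma fuzzyD_opp (R : realType) (u : R -> R) : fuzzyD u -> fuzzyD (u \o -%R).
Proof.
move=> [uC ud]; have [uf _] := uC; split; first exact: fuzzyC_opp.
have t0 : 0 <= (0 : R) <= 1 by rewrite lexx ler01.
by rewrite lend_opp// rend_opp// => x ?; apply: derivable_opp; apply: ud; lra.
Qed.

(** Fermat's rule: the sign of a left derivative at a maximum, applied to [f] and to its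
    reflection. *)
Lemma diff_within_max (R : realType) (f : R -> R) (a b x : R) :
  (forall y, f y <= f x) -> derivable f x 1 -> diff_within f a b x 0.
Proof.
move=> fx /derivable_diff_within[d fd]; suff <- : d = 0 by exact: fd.
apply/eqP; rewrite eq_le; apply/andP; split.
  rewrite -oppr_ge0; apply: (@diff_within_ge0 _ (f \o -%R) (- (x + 1)) (- x)).
  - by lra.
  - by move=> y _; rewrite /= opprK.
  - exact: diff_within_opp.
apply: (@diff_within_ge0 _ f (x - 1) x); [by lra|by []|exact: fd].
Qed.

Lemma supmin_conv1 (R : realType) (u w : R -> R) (p q p' q' z : R) :
  (forall x, u x <= 1) -> p <= q -> p' <= q' ->
  (forall x, p <= x <= q -> u x = 1) -> (forall x, p' <= x <= q' -> w x = 1) ->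
  p + p' <= z <= q + q' -> supmin_conv u w z = 1.
Proof.
(* This [x] lies in the core of [u] while [z - x] lies in that of [w], so the minimum there is 1,
   the largest possible value. *)
move=> u1 pq pq' up wp zb; pose x := Num.max p (z - q').
have [xpq xpq'] : p <= x <= q /\ p' <= z - x <= q'.
  by rewrite /x; case: (leP p (z - q')) => ?; split; lra.
rewrite (@supmin_conv_max _ _ _ _ x) up// wp// minxx// => y.
by rewrite ge_min u1.
Qed.

Lemma fuzzy_core (R : realType) (u : R -> R) (x : R) :
  fuzzy_number u -> lend u 1 <= x <= rend u 1 -> u x = 1.
Proof.
move=> uf xl; have I1 : 0 < (1 : R) <= 1 by rewrite lexx ltr01.
have [/(_ x) /andP[_ ux] _ _] := uf.
by apply/eqP; rewrite eq_le ux (ge_level _ uf I1).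
Qed.

(** * The two halves and the core put together *)

(** At the top the derivative is required to be 0 so that it can be glued to the core or to the
    right slope. The hypotheses are those of the left side alone, so the lemma also applies to the
    reflections of [u] and [w]. *)
Lemma left_half_diff (R : realType) (u w : R -> R) :
  fuzzyC u -> fuzzyD w -> w (lend w 0) = u (lend u 0) ->
  (lend u 0 < lend u 1 < rend u 0 -> ~ derivable u (lend u 1) 1 ->
    diff_within w (lend w 0) (lend w 1) (lend w 1) 0) ->
  (forall x, lend u 0 < x < lend u 1 -> ~ derivable u x 1 ->
    diff_within w (lend w (u x)) (lend w 1) (lend w (u x)) 0) ->
  forall z : R, lend u 0 + lend w 0 < z < rend u 0 + rend w 0 ->
  z <= lend u 1 + lend w 1 ->
  exists2 d, z = lend u 1 + lend w 1 -> d = 0 &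
    diff_within (supmin_conv u w)
      (lend u 0 + lend w 0) (lend u 1 + lend w 1) z d.
Proof.
move=> uC wD uw htop hleft z zb zP; have [wC wd] := wD.
have [[uf _] [wf _]] := (uC, wC).
have ru := fuzzyC_rising uC; have rw := fuzzyC_rising wC.
have top_le (v : R -> R) : fuzzyC v -> lend v 1 <= rend v 0.
  move=> vC; have [vf _] := vC.
  have := @gt0_level _ v (lend v 1) vf.
  by rewrite (rising_top (fuzzyC_rising vC)) ltr01 => /(_ isT) /andP[].
have pu := top_le _ uC; have pw := top_le _ wC.
have I1 : 0 < (1 : R) <= 1 by rewrite lexx ltr01.
have le1 (v : R -> R) y : fuzzyC v -> v y <= v (lend v 1).
  move=> vC; have [[/(_ y) /andP[_ vy] _ _] _] := vC.
  by rewrite (rising_top (fuzzyC_rising vC)).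
have [zltP|zgeP] := ltP z (lend u 1 + lend w 1).
  have [|||d zd] := diff_supmin_exists ru rw (esym uw) (z := z); last first.
  - by exists d => // zE; lra.
  - by lra.
  - move=> x xap; have [ux|/hleft wx] := pselect (derivable u x 1).
      by left; have [d ud] := derivable_diff_within ux; exists d; apply: ud.
    (* The least point of height [u x] on the slope of [w] is [lend w (u x)], the point about which
       [hleft] speaks. *)
    right=> y yap wyux yleast; suff <- : lend w (u x) = y by exact: wx.
    have ux1 : 0 < u x <= 1.
      rewrite (rising_gt0 ru)//=; last lra.
      by have := rising_itv ru x; lra.
    apply/eqP; rewrite eq_le; apply/andP; split.
      have : u x <= w y by rewrite wyux.
      by rewrite (ge_level _ wf ux1); lra.
    rewrite leNgt; apply/negP => /yleast; rewrite wyux ltNge.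
    by rewrite (ge_level _ wf ux1) lexx le_lend_rend//; lra.
  - move=> y yap; have [|d yd] := derivable_diff_within (wd y _); first lra.
    by exists d; apply: yd.
have zE : z = lend u 1 + lend w 1 by lra.
exists 0 => //; rewrite zE.
apply: (diff_supmin0 ru rw (esym uw) (coupled_top ru rw)).
(* Neither left slope is degenerate: if one were, the equal bottom values would be 1 and the other
   would be degenerate too, so [z] would be the left end of the support of the convolution. *)
have ltu : lend u 0 < lend u 1.
  rewrite ltNge; apply/negP => H.
  have E : lend u 0 = lend u 1 by have := rising_le ru; lra.
  have := rising_lt1 rw (x := lend w 0); rewrite uw E (rising_top ru) ltxx.
  by move=> H'; suff : false by []; apply: H'; lra.
have ltw : lend w 0 < lend w 1.
  rewrite ltNge; apply/negP => H.
  have E : lend w 0 = lend w 1 by have := rising_le rw; lra.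
  have := rising_lt1 ru (x := lend u 0); rewrite -uw E (rising_top rw) ltxx.
  by move=> H'; suff : false by []; apply: H'; lra.
(* If [lend u 1] is interior, [u] has derivative 0 there by Fermat's rule or [htop] applies. If not,
   [z < rend u 0 + rend w 0] makes [lend w 1] interior, and Fermat's rule applies to [w]. *)
have [pr|rp] := ltP (lend u 1) (rend u 0).
  have [up|up] := pselect (derivable u (lend u 1) 1); last first.
    by right; apply: htop => //; lra.
  by left; apply: diff_within_max up => y; apply: le1.
right; apply: diff_within_max => [y|]; first exact: le1.
by apply: wd; lra.
Qed.

Theorem theorem5p15 (R : realType) (u w : R -> R)
  (uC : fuzzyC u) (wD : fuzzyD w)
  (hi_l : w (lend w 0) = u (lend u 0))
  (hi_r : w (rend w 0) = u (rend u 0))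
  (hii_1 : lend u 0 < lend u 1 < rend u 0 -> ~ derivable u (lend u 1) 1 ->
     is_left_derive w (lend w 1) 0)
  (hii_2 : lend u 0 < rend u 1 < rend u 0 -> ~ derivable u (rend u 1) 1 ->
     is_right_derive w (rend w 1) 0)
  (hiv : forall x : R, lend u 0 < x < rend u 0 -> ~ derivable u x 1 ->
     (lend u 0 < x < lend u 1 -> is_right_derive w (lend w (u x)) 0) /\
     (rend u 1 < x < rend u 0 -> is_left_derive w (rend w (u x)) 0)) :
  smoother u w.
Proof.
have [[uf _] [wC wd]] := (uC, wD); have [wf _] := wC.
split=> //.
have ruC := fuzzyC_opp uC; have rwD := fuzzyD_opp wD.
have [rwC _] := rwD; have [[ruf _] [rwf _]] := (ruC, rwC).
have I0 : 0 <= (0 : R) <= 1 by rewrite lexx ler01.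
have I1 : 0 <= (1 : R) <= 1 by rewrite lexx ler01.
have ru := fuzzyC_rising uC; have rw := fuzzyC_rising wC.
have ru' := fuzzyC_rising ruC; have rw' := fuzzyC_rising rwC.
have E0u := lend_opp uf I0; have E0w := lend_opp wf I0.
have E1u := lend_opp uf I1; have E1w := lend_opp wf I1.
have F0u := rend_opp uf I0; have F0w := rend_opp wf I0.
have pq := le_lend_rend uf I1; have pq' := le_lend_rend wf I1.
set f := supmin_conv u w.
have rf : rising f (lend u 0 + lend w 0) (lend u 1 + lend w 1).
  exact: rising_supmin.
have rf' : rising (f \o -%R) (- (rend u 0 + rend w 0)) (- (rend u 1 + rend w 1)).
  rewrite /f -supmin_conv_opp !opprD -E0u -E0w -E1u -E1w.
  by apply: rising_supmin; rewrite // E0u E0w /= !opprK.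
have f1 x : lend u 1 + lend w 1 <= x <= rend u 1 + rend w 1 -> f x = 1.
  apply: supmin_conv1 => //; last 2 first.
  - by move=> y; apply: fuzzy_core.
  - by move=> y; apply: fuzzy_core.
  - by move=> y; have [/(_ y) /andP[]] := uf.
have PQ : lend u 1 + lend w 1 <= rend u 1 + rend w 1 by lra.
have [fC fl0 fr0] := rising_fuzzyC rf rf' PQ f1.
split=> // z; rewrite fl0 fr0 => zb.
have left_diff : z <= lend u 1 + lend w 1 ->
    exists2 d, z = lend u 1 + lend w 1 -> d = 0 &
    diff_within f (lend u 0 + lend w 0) (lend u 1 + lend w 1) z d.
  apply: left_half_diff => // [ub ux|x xb ux].
    by apply: left_derive_diff_within; apply: hii_1.
  have := rising_le ru'; rewrite E0u E1u => H.
  apply: right_derive_diff_within; apply: (proj1 (hiv x _ ux)) => //; lra.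
(* The left-half result for the reflections at [- z]; reflection exchanges left and right
   derivatives, turning (ii-2) and (iv-2) into the hypotheses needed. *)
have right_diff : rend u 1 + rend w 1 <= z ->
    exists2 d, z = rend u 1 + rend w 1 -> d = 0 &
    diff_within f (rend u 1 + rend w 1) (rend u 0 + rend w 0) z d.
  move=> Qz; have := @left_half_diff R (u \o -%R) (w \o -%R) ruC rwD.
  have hi' : (w \o -%R) (- rend w 0) = (u \o -%R) (- rend u 0).
    by rewrite /= !opprK.
  rewrite E0u E0w E1u E1w F0u F0w => /(_ hi').
  case/(_ _ _ (- z)).
  - move=> ub ux; rewrite -[0]oppr0; apply: diff_within_opp.
    apply: right_derive_diff_within; apply: hii_2; first lra.
    by move=> ud; apply: ux; apply: derivable_opp; rewrite opprK.
  - move=> x xb ux; have ux1 : 0 <= u (- x) <= 1 by have [/(_ (- x))] := uf.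
    rewrite (lend_opp wf ux1) -[X in diff_within _ _ _ _ X]oppr0.
    apply: diff_within_opp; apply: left_derive_diff_within.
    have nux : ~ derivable u (- x) 1.
      by move=> ud; apply: ux; apply: derivable_opp.
    have := rising_le ru => H.
    by apply: (proj2 (hiv (- x) _ nux)); lra.
  - by lra.
  - by lra.
  move=> d dz fd; exists (- d); first by move=> zE; rewrite dz ?oppr0//; lra.
  have := diff_within_opp fd; rewrite supmin_conv_opp comp_oppK opprK.
  by rewrite !opprD !opprK.
have [zP|Pz] := ltP z (lend u 1 + lend w 1).
  have [d _ fd] := left_diff (ltW zP).
  by apply: (diff_within_derivable _ fd); lra.
have [Qz|zQ] := ltP (rend u 1 + rend w 1) z.
  have [d _ fd] := right_diff (ltW Qz).
  by apply: (diff_within_derivable _ fd); lra.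
(* On the core both one-sided derivatives are 0: on each side of [z] the convolution is either
   constant nearby or continues along a slope starting at [z] with derivative 0. *)
have fz : f z = 1 by apply: f1; lra.
have fl : exists2 a, a < z & diff_within f a z z 0.
  have [Pz'|zP] := ltP (lend u 1 + lend w 1) z.
    exists (lend u 1 + lend w 1) => //; apply: diff_within_cst => y yb.
    by rewrite fz; apply: f1; lra.
  have zE : z = lend u 1 + lend w 1 by lra.
  have [d /(_ zE) -> fd] := left_diff zP.
  exists (lend u 0 + lend w 0); first lra.
  by apply: diff_withinW fd; lra.
have fr : exists2 b, z < b & diff_within f z b z 0.
  have [zQ'|Qz] := ltP z (rend u 1 + rend w 1).
    exists (rend u 1 + rend w 1) => //; apply: diff_within_cst => y yb.
    by rewrite fz; apply: f1; lra.
  have zE : z = rend u 1 + rend w 1 by lra.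
  have [d /(_ zE) -> fd] := right_diff Qz.
  exists (rend u 0 + rend w 0); first lra.
  by apply: diff_withinW fd; lra.
have [[a az fa] [b zb' fb]] := (fl, fr).
by apply: (diff_within_derivable _ (diff_within_cat fa fb)); rewrite az.
Qed.
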